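(* Let $S:\mathbb{R}^n\rightrightarrows\mathbb{R}^n$ be a set-valued operator and $X\subseteq\mathbb{R}^n$ a closed linear subspace. Suppose there are $\mu,\rho\in\mathbb{R}$ with $[\mu]_-[\rho]_-<1$ such that $S$ is $(\mu\Pi_{X^\perp},\rho\Pi_X)$-semimonotone at a solution $(x^\star,y^\star)\in\mathrm{link}_XS$, that $S$ is outer semicontinuous, and that the resolvent $J_{\gamma^{-1}S}$ has full domain, where $\gamma\in([\mu]_-,1/[\rho]_-)$, $\lambda_x\in(0,2(1+\gamma\rho))$ and $\lambda_y\in(0,2(1+\mu/\gamma))$. Let $(x^0,y^0)\in X\times X^\perp$ be arbitrary and let $(q^k,x^k,y^k)_{k\in\mathbb{N}}$ be generated by $$q^k\in J_{\gamma^{-1}S}(x^k+\gamma^{-1}y^k),\qquad x^{k+1}=(1-\lambda_x)x^k+\lambda_x\Pi_X(q^k),\qquad y^{k+1}=y^k-\lambda_y\gamma\,\Pi_{X^\perp}(q^k).$$ Define $\bar x^k:=\Pi_X(q^k)$ and $\bar y^k:=y^k-\gamma\Pi_{X^\perp}(q^k)$. Then either a point $(\bar x^k,\bar y^k)\in\mathrm{link}_XS$ is reached in a finite number of iterations, or the following hold. (i) The sequence $\bigl(\gamma\lambda_x^{-1}\|x^k-x^\star\|^2+\gamma^{-1}\lambda_y^{-1}\|y^k-y^\star\|^2\bigr)_{k\in\mathbb{N}}$ is nonincreasing (and $(x^k,y^k)\in X\times X^\perp$ for all $k$). (ii) Let $\bar\alpha:=\min\bigl(\tfrac{1+\gamma\rho}{\lambda_x},\tfrac{1+\mu/\gamma}{\lambda_y}\bigr)>\tfrac12$.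 For every $N\in\mathbb{N}$, $$\min_{k=0,\dots,N}\Bigl(\gamma\lambda_x\|\bar x^k-x^k\|^2+\gamma^{-1}\lambda_y\|\bar y^k-y^k\|^2\Bigr)\le\frac{\gamma\lambda_x^{-1}\|x^0-x^\star\|^2+\gamma^{-1}\lambda_y^{-1}\|y^0-y^\star\|^2}{(N+1)(2\bar\alpha-1)}.$$ Additionally, if $S$ is $(\mu\Pi_{X^\perp},\rho\Pi_X)$-semimonotone, then the sequence $\bigl(\gamma\lambda_x\|\bar x^k-x^k\|^2+\gamma^{-1}\lambda_y\|\bar y^k-y^k\|^2\bigr)_k$ is nonincreasing, and the minimum above is therefore attained at $k=N$. (iii) The sequences $(x^k,y^k)_k$ and $(\bar x^k,\bar y^k)_k$ are bounded and their limit points belong to $\mathrm{link}_XS$. (iv) If $\{(x^\star,y^\star)\}=\mathrm{link}_XS$, then the sequences $(x^k,y^k)_k$ and $(\bar x^k,\bar y^k)_k$ converge to some element of $\mathrm{link}_XS$.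
   Context: $\Pi_X,\Pi_{X^\perp}$ are the orthogonal projections onto $X$ and $X^\perp$; $[t]_-=-\min\{0,t\}$, with $1/0=+\infty$. $\mathrm{gph}\,S=\{(x,y):y\in S(x)\}$; $J_A=(\mathrm{id}+A)^{-1}$ is the resolvent (a set-valued operator; full domain means it is nonempty-valued everywhere). $S$ outer semicontinuous (everywhere) means $\mathrm{gph}\,S$ is closed in $\mathbb{R}^n\times\mathbb{R}^n$. $\mathrm{link}_XS$ is the set of all pairs $(x,y)$ with $x\in X$, $y\in X^\perp$, $y\in S(x)$. For symmetric matrices $M,R$, an operator $T$ is $(M,R)$-semimonotone at $(x',y')\in\mathrm{gph}\,T$ if $\langle x-x',y-y'\rangle\ge\langle x-x',M(x-x')\rangle+\langle y-y',R(y-y')\rangle$ for all $(x,y)\in\mathrm{gph}\,T$; it is $(M,R)$-semimonotone if this holds at every $(x',y')\in\mathrm{gph}\,T$. *)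

(* Defs.v *)
From HB Require Import structures.
From mathcomp Require Import all_boot all_order all_algebra.
From mathcomp Require Import all_classical all_reals all_analysis.
From mathcomp Require Import sesquilinear.

Set Implicit Arguments.
Unset Strict Implicit.
Unset Printing Implicit Defensive.

Import Order.TTheory GRing.Theory Num.Theory.
Import numFieldNormedType.Exports.

Local Open Scope classical_set_scope.
Local Open Scope ring_scope.

(* Elements of R^n are row vectors, so a matrix M acts by x |-> x *m M.  The
   library norm on 'rV[R]_n is the sup norm: it is only used for topology and
   boundedness, and every norm in a formula is enorm below. *)

Section InnerProduct.
Variables (R : realType) (n : nat).

Definition rdot (u v : 'rV[R]_n) : R := form_of_matrix idfun 1%:M u v.

HB.instance Definition _ := Bilinear.copy rdot (form_of_matrix idfun 1%:M).

Lemma rdotE (u v : 'rV[R]_n) : rdot u v = \sum_i u 0 i * v 0 i.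
Proof.
rewrite /rdot /form_of_matrix mulmx1 /mxtrace big_ord1 mxE.
by apply: eq_bigr => i _; rewrite !mxE.
Qed.

Lemma rdot_hermitian u v : rdot u v = (-1) ^+ false * idfun (rdot v u).
Proof.
by rewrite mul1r !rdotE; apply: eq_bigr => i _; rewrite mulrC.
Qed.

HB.instance Definition _ :=
  isHermitianSesquilinear.Build R 'rV[R]_n false idfun rdot rdot_hermitian.

Lemma rdot_gt0 u : u != 0 -> 0 < rdot u u.
Proof.
move=> u0; rewrite rdotE lt_def sumr_ge0 ?andbT; last first.
  by move=> i _; rewrite -expr2 sqr_ge0.
apply: contra_neq u0 => /psumr_eq0P h; apply/rowP => i; rewrite mxE.
by apply/eqP; rewrite -sqrf_eq0 expr2 h// => j _; rewrite -expr2 sqr_ge0.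
Qed.

HB.instance Definition _ := isDotProduct.Build R 'rV[R]_n rdot rdot_gt0.

Definition enorm (x : 'rV[R]_n) : R := Num.sqrt (rdot x x).

Definition orthocomp (X : {vspace 'rV[R]_n}) : {vspace 'rV[R]_n} :=
  orthov rdot X.

(* Projection onto X along orthocomp X; these two are complementary by
   cap_orthocomp and add_orthocomp, so no junk value is involved. *)
Definition orthoproj (X : {vspace 'rV[R]_n}) : 'End('rV[R]_n) :=
  daddv_pi X (orthocomp X).

Definition orthoproj_mx (X : {vspace 'rV[R]_n}) : 'M[R]_n :=
  lin1_mx (orthoproj X).

End InnerProduct.

Section Operators.
Variables (R : realType) (n : nat).
Local Notation V := 'rV[R]_n.
Implicit Types (S T : V -> set V) (X : {vspace V}).

Definition gph S : set (V * V) := [set z | S z.1 z.2].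

Definition dom S : set V := [set x | S x !=set0].

Definition outer_semicontinuous S : Prop := closed (gph S).

Definition op_scale (c : R) S : V -> set V := fun x => [set c *: y | y in S x].

Definition op_id_add S : V -> set V := fun x => [set x + y | y in S x].

Definition op_inv S : V -> set V := fun y => [set x | S x y].

Definition resolvent S : V -> set V := op_inv (op_id_add S).

Definition link X S : set (V * V) :=
  [set z | [/\ z.1 \in X, z.2 \in orthocomp X & S z.1 z.2]].

(* Used for symmetric M and N only (cf. orthoproj_mx_sym), for which x *m M is
   the transpose of the column vector M x. *)
Definition semimonotone_at (M N : 'M[R]_n) T (z' : V * V) : Prop :=
  forall z, gph T z ->
    rdot (z.1 - z'.1) ((z.1 - z'.1) *m M) + rdot (z.2 - z'.2) ((z.2 - z'.2) *m N)
    <= rdot (z.1 - z'.1) (z.2 - z'.2).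

Definition semimonotone (M N : 'M[R]_n) T : Prop :=
  forall z', gph T z' -> semimonotone_at M N T z'.

End Operators.

Definition negpart (R : realType) (t : R) : R := - Num.min 0 t.

Section Checks.
Variables (R : realType) (n : nat).
Implicit Types (X : {vspace 'rV[R]_n}) (u v x : 'rV[R]_n).

Lemma rdotC u v : rdot u v = rdot v u.
Proof. by rewrite rdot_hermitian mul1r. Qed.

Lemma mem_orthocomp X u :
  reflect (forall v, v \in X -> rdot u v = 0) (u \in orthocomp X).
Proof. exact: mem_orthovP. Qed.

Lemma cap_orthocomp X : (X :&: orthocomp X = 0)%VS.
Proof.
apply/eqP; rewrite -subv0; apply/subvP => u.
rewrite memv_cap => /andP[uX /mem_orthocomp/(_ _ uX) uu].
by rewrite memv0; apply: contraT => /rdot_gt0; rewrite uu ltxx.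
Qed.

Lemma add_orthocomp X : (X + orthocomp X = fullv)%VS.
Proof.
apply/eqP; rewrite eqEdim subvf /= dimv_disjoint_sum ?cap_orthocomp//.
have -> : orthocomp X = lker (linfun (mulmxr
    (\matrix_(i < \dim X) (vbasis X)`_i : 'M[R]_(_, n))^T : 'rV[R]_n -> 'rV_(\dim X))).
  apply/vspaceP => u; rewrite memv_ker lfunE /=.
  apply/mem_orthocomp/eqP => [h|/rowP h v /coord_vbasis ->].
    apply/rowP => i; rewrite !mxE -[RHS](h (vbasis X)`_i) ?vbasis_mem ?mem_nth ?size_tuple//.
    by rewrite rdotE; apply: eq_bigr => j _; rewrite !mxE.
  rewrite linear_sumr big1//= => i _; rewrite linearZr /=.
  have := h i; rewrite !mxE => hi.
  suff -> : rdot u (vbasis X)`_i = 0 by rewrite mulr0.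
  by rewrite rdotE -[RHS]hi; apply: eq_bigr => j _; rewrite !mxE.
set f := linfun _.
rewrite -(limg_ker_dim f fullv) capfv addnC leq_add2r.
by rewrite (leq_trans (dimvS (subvf _)))// dimvf /dim /= mul1n.
Qed.

Lemma orthoproj_mem X x : orthoproj X x \in X.
Proof. exact: memv_pi. Qed.

Lemma orthoproj_orth X x : x - orthoproj X x \in orthocomp X.
Proof.
have -> : x - orthoproj X x = daddv_pi (orthocomp X) X x.
  by apply/eqP; rewrite subr_eq addrC daddv_pi_add ?cap_orthocomp//
    add_orthocomp memvf.
exact: memv_pi.
Qed.

Lemma orthoproj_mxE X x : x *m orthoproj_mx X = orthoproj X x.
Proof. by rewrite mul_rV_lin1. Qed.

Lemma orthoproj_mx_sym X : (orthoproj_mx X)^T = orthoproj_mx X.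
Proof.
have sym u v : rdot (orthoproj X u) v = rdot u (orthoproj X v).
  have h a b : rdot (orthoproj X a) b = rdot (orthoproj X a) (orthoproj X b).
    rewrite -{1}(subrK (orthoproj X b) b) linearDr /=.
    by rewrite rdotC (mem_orthocomp _ _ (orthoproj_orth X b)) ?add0r ?orthoproj_mem.
  by rewrite h rdotC -h rdotC.
apply/matrixP => i j; rewrite mxE.
have e (k : 'I_n) (u : 'rV[R]_n) : rdot u 'e_k = u 0 k.
  rewrite rdotE (bigD1 k)//= mxE !eqxx mulr1 big1 ?addr0// => l lk.
  by rewrite mxE (negbTE lk) andbF mulr0.
have := sym 'e_j 'e_i; rewrite [RHS]rdotC !e -!orthoproj_mxE -!rowE.
by rewrite !mxE.
Qed.

End Checks.

(* Main.v *)
(* Put a^k = x^k - xb^k and b^k = y^k - yb^k.  The resolvent inclusion says that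
   (x^k - a^k + b^k / gamma, gamma a^k + y^k - b^k) lies on the graph of S, and
   the iteration reads x^(k+1) = x^k - lambdax a^k, y^(k+1) = y^k - lambday b^k.
   Splitting the inner product along X and its complement, semimonotonicity at
   (xs, ys) becomes
     alpha D_k <= gamma <x^k - xs, a^k> + <y^k - ys, b^k> / gamma,
   which is E_(k+1) <= E_k - (2 alpha - 1) D_k; the same inequality between two
   consecutive iterates gives D_(k+1) <= D_k.  Hence D is summable, a^k and b^k
   tend to 0, and limit points are in the link because the graph is closed.
   Conclusions (i)-(iv) hold unconditionally, so the right disjunct is always
   the one proved. *)
Require Import Defs.
From mathcomp Require Import all_boot all_order all_algebra.
From mathcomp Require Import all_classical all_reals all_analysis.
From mathcomp Require Import sesquilinear ring lra.

Set Implicit Arguments.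
Unset Strict Implicit.
Unset Printing Implicit Defensive.

Import Order.TTheory GRing.Theory Num.Theory.
Import numFieldNormedType.Exports.

Local Open Scope classical_set_scope.
Local Open Scope ring_scope.

(** * Euclidean geometry of a subspace and its orthogonal complement *)

Section OrthogonalDecomposition.
Variables (R : realType) (n : nat).
Implicit Types (X : {vspace 'rV[R]_n}) (u v w a b : 'rV[R]_n).

Lemma rdotDl u v w : rdot (u + v) w = rdot u w + rdot v w.
Proof. exact: linearDl. Qed.

Lemma rdotDr u v w : rdot u (v + w) = rdot u v + rdot u w.
Proof. exact: linearDr. Qed.

Lemma rdotNl u v : rdot (- u) v = - rdot u v.
Proof. exact: linearNl. Qed.

Lemma rdotNr u v : rdot u (- v) = - rdot u v.
Proof. exact: linearNr. Qed.

Lemma rdotZl c u v : rdot (c *: u) v = c * rdot u v.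
Proof. exact: linearZl. Qed.

Lemma rdotZr c u v : rdot u (c *: v) = c * rdot u v.
Proof. exact: linearZr. Qed.

Definition rdot_lin := (rdotDl, rdotDr, rdotNl, rdotNr, rdotZl, rdotZr).

Lemma rdot_ge0 u : 0 <= rdot u u.
Proof. by rewrite rdotE sumr_ge0 // => i _; rewrite -expr2 sqr_ge0. Qed.

Lemma rdotBB u v : rdot (u - v) (u - v) = rdot u u - 2 * rdot u v + rdot v v.
Proof. by rewrite !rdot_lin (rdotC v u); ring. Qed.

Lemma enorm_sqr u : enorm u ^+ 2 = rdot u u.
Proof. exact/sqr_sqrtr/rdot_ge0. Qed.

(** The sup norm is attained at some coordinate, whose square is one term of the sum of squares.
    This carries Euclidean estimates over to the topology. *)
Lemma norm_le_sqrt_rdot u : `|u| <= Num.sqrt (rdot u u).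
Proof.
change (mx_norm u <= Num.sqrt (rdot u u)).
have [->|/mx_norm_neq0[[i j] ->]] := eqVneq (mx_norm u) 0.
  exact: sqrtr_ge0.
rewrite -sqrtr_sqr ler_sqrt ?rdot_ge0//= rdotE (bigD1 j)//= ord1 -expr2.
by rewrite lerDl sumr_ge0// => k _; rewrite -expr2 sqr_ge0.
Qed.

Lemma rdot_orth X a b : a \in X -> b \in orthocomp X -> rdot a b = 0.
Proof. by move=> aX /mem_orthocomp/(_ _ aX); rewrite rdotC. Qed.

(** For [u] in the double complement with projection [p], the vector [u - p] is orthogonal to both
    [u] and [p], hence to itself. *)
Lemma orthocompK X : orthocomp (orthocomp X) = X.
Proof.
apply/vspaceP => u; apply/idP/idP => [uXX|uX]; last first.
  by apply/mem_orthocomp => v vX; exact: rdot_orth uX vX.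
have := orthoproj_orth X u; set p := orthoproj X u => up.
have pX : p \in X by exact: orthoproj_mem.
suff : u - p == 0 by rewrite subr_eq0 => /eqP ->.
apply: contraT => /rdot_gt0.
rewrite {1}rdotDl rdotNl (rdot_orth pX up) (rdotC u) (rdot_orth up uXX).
by rewrite subr0 ltxx.
Qed.

Lemma orthoprojD X a b :
  a \in X -> b \in orthocomp X -> orthoproj X (a + b) = a.
Proof.
move=> aX bX; rewrite linearD /= {1}/orthoproj daddv_pi_id ?cap_orthocomp//.
have := orthoproj_orth X b; have := orthoproj_mem X b.
set p := orthoproj X b => pX bp.
suff /eqP : p \in (X :&: orthocomp X)%VS.
  rewrite cap_orthocomp memv0 eqb_id => /eqP ->; rewrite addr0 //.
by rewrite memv_cap pX -[p](subKr b) rpredB.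
Qed.

Lemma orthoproj_compD X a b :
  a \in X -> b \in orthocomp X -> orthoproj (orthocomp X) (a + b) = b.
Proof. by move=> aX bX; rewrite addrC orthoprojD// orthocompK. Qed.

Lemma orthoproj_compE X u : orthoproj (orthocomp X) u = u - orthoproj X u.
Proof.
rewrite -{1}(subrKC (orthoproj X u) u).
by apply: orthoproj_compD; [exact: orthoproj_mem|exact: orthoproj_orth].
Qed.

Lemma continuous_rdotl v : continuous (fun u => rdot u v).
Proof.
rewrite (_ : (fun u => _) = fun u => \sum_i u 0 i * v 0 i); last first.
  by apply/funext => u; exact: rdotE.
apply: (@continuous_big R _ +%R) => [|i _ u].
  exact: add_continuous.
exact: (cvgM (@coord_continuous _ _ _ 0 i u) (cvg_cst (v 0 i))).
Qed.

(** By [orthocompK], [X] is an intersection of kernels of continuous functionals. *)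
Lemma closed_vspace X : closed [set u | u \in X].
Proof.
have -> : [set u | u \in X] =
    \bigcap_(v in [set v | v \in orthocomp X]) [set u | rdot u v = 0].
  apply/seteqP; split => u /= uX; first by move=> v vX; exact: rdot_orth uX vX.
  by rewrite -(orthocompK X); apply/mem_orthocomp.
apply: closed_bigI => v _.
apply: (@preimage_closed _ _ (fun u => rdot u v) [set x | x = 0]); last exact: closed_eq.
by move=> u _; exact: continuous_rdotl.
Qed.

End OrthogonalDecomposition.

(** * Cluster points of sequences *)

Section SequenceCluster.

Lemma cluster_sub_cvg0 (R : realType) (V : normedModType R) (f g : nat -> V) :
  (fun k => f k - g k) @ \oo --> (0 : V) ->
  cluster (f @ \oo) `<=` cluster (g @ \oo).
Proof.
move=> fg z zf A B [N _ NA] /nbhs_ballP[e /= e0 eB].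
have e20 : 0 < e / 2 by rewrite divr_gt0.
have /cvgr0Pnorm_lt/(_ _ e20)[M _ NM] := fg.
(* Testing the cluster point against the image of a tail yields an index beyond both thresholds. *)
have [|w [[k /= Nk <-] fk]] :=
    zf (f @` [set k | (maxn N M <= k)%N]) _ _ (nbhsx_ballx z _ e20).
  by exists (maxn N M) => // k /= Nk; exists k.
exists (g k); split; first by apply: NA => /=; exact: leq_trans (leq_maxl _ _) Nk.
apply: eB; apply: (@ball_split _ _ (f k)) => //.
by rewrite -ball_normE /=; apply: NM => /=; exact: leq_trans (leq_maxr _ _) Nk.
Qed.

Lemma closed_cluster_seq (T : topologicalType) (A : set T) (f : nat -> T) :
  closed A -> (forall k, A (f k)) -> cluster (f @ \oo) `<=` A.
Proof.
move=> cA fA; rewrite clusterE => z /(_ A); rewrite -(closure_id A).1//; apply.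
by exists 0%N => // k _; exact: fA.
Qed.

(** A filter on a compact set that has a single cluster point converges to it. *)
Lemma bounded_cvg_cluster1 (R : realType) n (f : nat -> 'rV[R]_n * 'rV[R]_n)
    (z : 'rV[R]_n * 'rV[R]_n) :
  bounded_fun f -> cluster (f @ \oo) `<=` [set z] -> f @ \oo --> z.
Proof.
move=> [M [_ fM]] fz.
(* This radius makes the compact box contain the whole sequence and also the unit ball around [z],
   so that the box is a neighbourhood of [z]. *)
pose r := Num.max (M + 1) (`|z| + 1).
pose A := [set u : 'rV[R]_n | `|u| <= r].
have cA : compact (A `*` A).
  have cA : compact A.
    apply: bounded_closed_compact.
      exists r; split=> [|s rs u /= ur]; first exact: num_real.
      exact: le_trans ur (ltW rs).
    apply: (@preimage_closed _ _ (fun u : 'rV[R]_n => `|u|) [set s | s <= r]).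
      by move=> u _; exact: norm_continuous.
    exact: closed_le.
  exact: compact_setX.
have AE w : `|w| <= r -> (A `*` A) w by rewrite prod_normE ge_max => /andP[].
have fA : (f @ \oo) (A `*` A).
  exists 0%N => // k _; apply: AE; rewrite le_max; apply/orP; left.
  by apply: fM => //; rewrite ltrDl.
apply: (compact_cluster_set1 (V := A `*` A)) => //.
- apply: filterS (nbhsx_ballx z 1 ltr01) => w; rewrite prod_norm_ball => zw.
  apply: AE; rewrite le_max; apply/orP; right.
  have := ler_normB z (z - w); rewrite subKr => /le_trans; apply.
  by rewrite lerD2l ltW.
- apply/seteqP; split => // _ ->.
  by have [w [_ wf]] := cA _ _ fA; rewrite -(fz w wf).
Qed.

Lemma closed_setM (T U : topologicalType) (A : set T) (B : set U) :
  closed A -> closed B -> closed (A `*` B).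
Proof.
move=> cA cB; have -> : A `*` B = fst @^-1` A `&` snd @^-1` B by [].
apply: closedI; apply: preimage_closed => // z _; first exact: cvg_fst.
exact: cvg_snd.
Qed.

End SequenceCluster.

(** * One relaxed step: coercivity and expansions of squares *)

Section Relaxation.
Variables (R : realType) (n : nat).
Local Notation V := 'rV[R]_n.
Implicit Types (S : V -> set V) (X : {vspace V}) (u v a b : V).

(* With [u], [v] the displacements of two iterates and [a], [b] those of their
   fixed-point residuals, [q1 - q2] and [s1 - s2] split along [X] and its
   complement, and semimonotonicity becomes coercivity of the residual map. *)
Lemma semimonotone_residual X S mu rho gamma q1 s1 q2 s2 u v a b :
  0 < gamma ->
  semimonotone_at (mu *: orthoproj_mx (orthocomp X)) (rho *: orthoproj_mx X)
    S (q2, s2) ->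
  S q1 s1 -> u \in X -> a \in X -> v \in orthocomp X -> b \in orthocomp X ->
  q1 - q2 = u - a + gamma^-1 *: b -> s1 - s2 = gamma *: a + (v - b) ->
  gamma * (1 + gamma * rho) * rdot a a + gamma^-1 * (1 + mu / gamma) * rdot b b
    <= gamma * rdot u a + gamma^-1 * rdot v b.
Proof.
move=> g0 mono S1 uX aX vX bX dq ds; have := mono (q1, s1) S1; rewrite /= dq ds.
rewrite -!scalemxAr !orthoproj_mxE.
rewrite (orthoproj_compD (rpredB uX aX) (rpredZ _ bX)).
rewrite (orthoprojD (rpredZ _ aX) (rpredB vX bX)) !rdot_lin.
(* All pairings between [X] and its complement vanish; only [A], [B], [U] and [W] survive. *)
have orth a' b' : a' \in X -> b' \in orthocomp X ->
    (rdot a' b' = 0) * (rdot b' a' = 0).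
  by move=> a'X b'X; rewrite (rdotC b') (rdot_orth a'X b'X).
rewrite !(orth a b) // !(orth u b) // !(orth u v) // !(orth a v) // (rdotC b v).
set A := rdot a a; set B := rdot b b; set U := rdot u a; set W := rdot v b.
move=> h; rewrite -subr_ge0; move: h; rewrite -subr_ge0.
by congr (0 <= _); field; rewrite gt_eqF.
Qed.

Variables gamma lambdax lambday : R.
Hypotheses (g0 : 0 < gamma) (lx0 : 0 < lambdax) (ly0 : 0 < lambday).

Definition lyapunov u v : R :=
  gamma * lambdax^-1 * rdot u u + gamma^-1 * lambday^-1 * rdot v v.

(** This is [lyapunov] evaluated at the actual step [lambdax *: a], [lambday *: b]. *)
Definition residual a b : R :=
  gamma * lambdax * rdot a a + gamma^-1 * lambday * rdot b b.

Lemma lyapunov_ge0 u v : 0 <= lyapunov u v.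
Proof.
by rewrite addr_ge0// mulr_ge0 ?rdot_ge0// mulr_ge0 ?invr_ge0// ltW.
Qed.

Lemma residual_ge0 a b : 0 <= residual a b.
Proof.
by rewrite addr_ge0// mulr_ge0 ?rdot_ge0// mulr_ge0 ?invr_ge0// ltW.
Qed.

Lemma residual_le_min mu rho a b :
  Num.min ((1 + gamma * rho) / lambdax) ((1 + mu / gamma) / lambday) * residual a b
  <= gamma * (1 + gamma * rho) * rdot a a
     + gamma^-1 * (1 + mu / gamma) * rdot b b.
Proof.
set m := Num.min _ _; rewrite mulrDr lerD//.
  rewrite mulrA ler_wpM2r ?rdot_ge0// mulrCA ler_pM2l//.
  by rewrite -ler_pdivlMr// /m ge_min lexx.
rewrite mulrA ler_wpM2r ?rdot_ge0// mulrCA ler_pM2l ?invr_gt0//.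
by rewrite -ler_pdivlMr// /m ge_min lexx orbT.
Qed.

(** The cross term of the expanded squares is exactly what [semimonotone_residual] bounds from
    below. *)
Lemma lyapunov_step u v a b :
  lyapunov (u - lambdax *: a) (v - lambday *: b) =
  lyapunov u v - 2 * (gamma * rdot u a + gamma^-1 * rdot v b) + residual a b.
Proof.
rewrite /lyapunov /residual !rdotBB !rdot_lin.
set A := rdot a a; set B := rdot b b; set U := rdot u a; set W := rdot v b.
by field; rewrite !gt_eqF.
Qed.

(** The cross term is written with [lambdax *: a] and [lambday *: b] because these are, up to sign,
    the displacements between consecutive iterates. *)
Lemma residualD a b a' b' :
  residual (a + a') (b + b') = residual a b + residual a' b'
    + 2 * (gamma * rdot (lambdax *: a) a' + gamma^-1 * rdot (lambday *: b) b').
Proof. by rewrite /residual !rdot_lin (rdotC a' a) (rdotC b' b); ring. Qed.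

End Relaxation.

(** * Minima, summability and norm bounds for sequences *)

Section RealSequences.
Variable R : realType.

Lemma min_le_average (D : nat -> R) N :
  \big[Num.min/D 0%N]_(k < N.+1) D k <= (\sum_(k < N.+1) D k) / N.+1%:R.
Proof.
rewrite ler_pdivlMr ?ltr0n// mulr_natr; set m := \big[_/_]_(_ < _) _.
have -> : m *+ N.+1 = \sum_(k < N.+1) m by rewrite sumr_const card_ord.
by apply: ler_sum => k _; exact: (bigmin_le _ _ (fun i : 'I_N.+1 => D i)).
Qed.

Lemma bigmin_nonincreasing (D : nat -> R) N :
  nonincreasing_seq D -> \big[Num.min/D 0%N]_(k < N.+1) D k = D N.
Proof.
move=> Dn; apply/eqP; rewrite eq_le (bigmin_le _ (@ord_max N))/=.
by apply: le_bigmin => [|i _]; apply: Dn; rewrite // -ltnS.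
Qed.

Lemma cvg_summable0 (D : nat -> R) C :
  (forall k, 0 <= D k) -> (forall N, \sum_(k < N) D k <= C) -> D @ \oo --> 0.
Proof.
move=> D0 DC; apply: cvg_series_cvg_0; apply: nondecreasing_is_cvgn.
  by apply: nondecreasing_series => k _ _.
by exists C => _ [N _ <-]; rewrite /series /= big_mkord.
Qed.

Lemma bounded_fun_le (V : normedModType R) (f : nat -> V) M :
  (forall k, `|f k| <= M) -> bounded_fun f.
Proof.
move=> fM; exists M; split=> [|s Ms k _]; first exact: num_real.
exact: le_trans (fM k) (ltW Ms).
Qed.

Lemma norm_le_rdot n (u : 'rV[R]_n) c t :
  0 < c -> c * rdot u u <= t -> `|u| <= Num.sqrt (t / c).
Proof.
move=> c0 ut; apply: le_trans (norm_le_sqrt_rdot u) _.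
by rewrite ler_wsqrtr// ler_pdivlMr// mulrC.
Qed.

Lemma cvg0_rdot n (u : nat -> 'rV[R]_n) (D : nat -> R) c :
  0 < c -> (forall k, c * rdot (u k) (u k) <= D k) -> D @ \oo --> 0 ->
  u @ \oo --> (0 : 'rV[R]_n).
Proof.
move=> c0 uD D0; apply: norm_cvg0.
apply: (@squeeze_cvgr _ _ _ _ (fun=> 0) (fun k => Num.sqrt (D k / c))).
- by apply: nearW => k; rewrite normr_ge0 (norm_le_rdot c0).
- exact: cvg_cst.
- rewrite -(sqrtr0 R) -(mul0r c^-1).
  apply: continuous_cvg; first exact: sqrt_continuous.
  by apply: cvgM D0 (cvg_cst _).
Qed.

End RealSequences.

(** * Convergence of the relaxed iteration *)

Theorem corollary4p10 (R : realType) (n : nat)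
    (S : 'rV[R]_n -> set 'rV[R]_n) (X : {vspace 'rV[R]_n})
    (mu rho : R) (xs ys : 'rV[R]_n) (gamma lambdax lambday : R)
    (q x y : nat -> 'rV[R]_n)
    (hmurho : negpart mu * negpart rho < 1)
    (hlink : link X S (xs, ys))
    (hsemi : semimonotone_at (mu *: orthoproj_mx (orthocomp X))
               (rho *: orthoproj_mx X) S (xs, ys))
    (hosc : outer_semicontinuous S)
    (hdom : dom (resolvent (op_scale gamma^-1 S)) = setT)
    (hgamma1 : negpart mu < gamma)
    (hgamma2 : (gamma%:E < (negpart rho)%:E^-1)%E)
    (hlambdax : 0 < lambdax < 2 * (1 + gamma * rho))
    (hlambday : 0 < lambday < 2 * (1 + mu / gamma))
    (hx0 : x 0%N \in X) (hy0 : y 0%N \in orthocomp X)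
    (hq : forall k,
        resolvent (op_scale gamma^-1 S) (x k + gamma^-1 *: y k) (q k))
    (hx : forall k,
        x k.+1 = (1 - lambdax) *: x k + lambdax *: orthoproj X (q k))
    (hy : forall k,
        y k.+1 = y k - (lambday * gamma) *: orthoproj (orthocomp X) (q k)) :
  let xb k := orthoproj X (q k) in
  let yb k := y k - gamma *: orthoproj (orthocomp X) (q k) in
  let E k := gamma * lambdax^-1 * enorm (x k - xs) ^+ 2
             + gamma^-1 * lambday^-1 * enorm (y k - ys) ^+ 2 in
  let D k := gamma * lambdax * enorm (xb k - x k) ^+ 2
             + gamma^-1 * lambday * enorm (yb k - y k) ^+ 2 in
  let alpha := Num.min ((1 + gamma * rho) / lambdax)
                       ((1 + mu / gamma) / lambday) in
  let minD N := \big[Num.min/D 0%N]_(k < N.+1) D k in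
  (exists k, link X S (xb k, yb k)) \/
  [/\ (* (i) *)
      nonincreasing_seq E /\
      (forall k, x k \in X /\ y k \in orthocomp X),
      (* (ii) *)
      [/\ 2^-1 < alpha,
          forall N, minD N <= E 0%N / (N.+1%:R * (2 * alpha - 1)) &
          semimonotone (mu *: orthoproj_mx (orthocomp X))
            (rho *: orthoproj_mx X) S ->
          nonincreasing_seq D /\ forall N, minD N = D N],
      (* (iii) *)
      [/\ bounded_fun (fun k => (x k, y k)),
          bounded_fun (fun k => (xb k, yb k)),
          cluster ((fun k => (x k, y k)) @ \oo) `<=` link X S &
          cluster ((fun k => (xb k, yb k)) @ \oo) `<=` link X S] &
      (* (iv) *)
      ([set (xs, ys)] = link X S ->
       exists z, [/\ link X S z,
         (fun k => (x k, y k)) @ \oo --> z &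
         (fun k => (xb k, yb k)) @ \oo --> z])].
Proof.
move=> xb yb E D alpha minD; right.
(* [negpart mu] is nonnegative, so [hgamma1] makes [gamma] positive. *)
have g0 : 0 < gamma.
  by apply: le_lt_trans hgamma1; rewrite oppr_ge0 ge_min lexx.
have [lx0 lx2] := andP hlambdax; have [ly0 ly2] := andP hlambday.
have [xsX ysX sS] := hlink.
pose a k := x k - xb k; pose b k := y k - yb k.
(* The element of [S (q k)] selected by the resolvent: [gamma] times the gap between its argument
   and [q k]. *)
pose s k := gamma *: a k + yb k.
have xX k : x k \in X.
  by elim: k => // k IH; rewrite hx rpredD ?rpredZ ?orthoproj_mem.
have yX k : y k \in orthocomp X.
  by elim: k => // k IH; rewrite hy rpredB ?rpredZ ?orthoproj_mem.
have aX k : a k \in X by rewrite rpredB ?orthoproj_mem.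
have bE k : b k = gamma *: orthoproj (orthocomp X) (q k) by rewrite /b subKr.
have bX k : b k \in orthocomp X by rewrite bE rpredZ ?orthoproj_mem.
have qE k : q k = x k - a k + gamma^-1 *: b k.
  by rewrite subKr bE scalerA mulVf ?gt_eqF// scale1r orthoproj_compE subrKC.
have sE k : s k = gamma *: a k + (y k - b k) by rewrite /b subKr.
have qS k : S (q k) (s k).
  have [_ [t tS <-]] := hq k.
  move=> /(congr1 (fun w => gamma *: (w - q k))).
  rewrite addrAC subrr add0r scalerA mulfV ?gt_eqF// scale1r => tE.
  suff -> : s k = t by [].
  rewrite sE tE qE; apply/rowP => i; rewrite !mxE; field.
  by rewrite gt_eqF.
have xS k : x k.+1 = x k - lambdax *: a k.
  by rewrite hx /a scalerBr scalerBl scale1r opprB addrA addrAC.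
have yS k : y k.+1 = y k - lambday *: b k by rewrite hy bE scalerA.
have DE k : D k = residual gamma lambdax lambday (a k) (b k).
  rewrite /D !enorm_sqr -(opprB (x k)) -(opprB (y k)).
  by rewrite !rdotNl !rdotNr !opprK.
have EE k : E k = lyapunov gamma lambdax lambday (x k - xs) (y k - ys).
  by rewrite /E /lyapunov !enorm_sqr.
have D0 k : 0 <= D k by rewrite DE residual_ge0.
have E0 k : 0 <= E k by rewrite EE lyapunov_ge0.
(* The upper bounds on [lambdax] and [lambday], rearranged. *)
have alpha_gt : 2^-1 < alpha.
  by rewrite lt_min !ltr_pdivlMr// !ltr_pdivrMl// lx2 ly2.
have alpha0 : 0 < 2 * alpha - 1 by rewrite subr_gt0 -ltr_pdivrMl// mulr1.
have descent k : E k.+1 + (2 * alpha - 1) * D k <= E k.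
  have := semimonotone_residual g0 hsemi (qS k) (rpredB (xX k) xsX) (aX k)
    (rpredB (yX k) ysX) (bX k).
  have -> : q k - xs = x k - xs - a k + gamma^-1 *: b k.
    by rewrite qE; apply/rowP => i; rewrite !mxE; ring.
  have -> : s k - ys = gamma *: a k + (y k - ys - b k).
    by rewrite sE; apply/rowP => i; rewrite !mxE; ring.
  move=> /(_ erefl erefl) /(le_trans (residual_le_min g0 lx0 ly0 mu rho _ _)).
  rewrite -DE EE xS yS (addrAC (x k)) (addrAC (y k)) lyapunov_step//.
  by rewrite -EE -DE -/alpha; lra.
have Enon : nonincreasing_seq E.
  apply/nonincreasing_seqP => k; apply: le_trans (descent k).
  by rewrite lerDl mulr_ge0// ltW.
have sumD N : \sum_(k < N) D k <= E 0%N / (2 * alpha - 1).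
  rewrite ler_pdivlMr// mulrC.
  (* Keeping [E N] lets the descent inequality telescope; being nonnegative, it is then dropped. *)
  suff : (2 * alpha - 1) * (\sum_(k < N) D k) + E N <= E 0%N.
    by apply: le_trans; rewrite lerDl.
  elim: N => [|N IH]; first by rewrite big_ord0 mulr0 add0r.
  rewrite big_ord_recr /= mulrDr; have := descent N; lra.
have Dcvg : D @ \oo --> 0 by exact: cvg_summable0 D0 sumD.
have cDx : 0 < gamma * lambdax by rewrite mulr_gt0.
have cDy : 0 < gamma^-1 * lambday by rewrite mulr_gt0 ?invr_gt0.
have aD k : gamma * lambdax * rdot (a k) (a k) <= D k.
  by rewrite DE lerDl mulr_ge0 ?rdot_ge0// ltW.
have bD k : gamma^-1 * lambday * rdot (b k) (b k) <= D k.
  by rewrite DE lerDr mulr_ge0 ?rdot_ge0// ltW.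
have acvg : a @ \oo --> (0 : 'rV[R]_n) by exact: cvg0_rdot cDx aD Dcvg.
have bcvg : b @ \oo --> (0 : 'rV[R]_n) by exact: cvg0_rdot cDy bD Dcvg.
have xy_bounded : bounded_fun (fun k => (x k, y k)).
  have cEx : 0 < gamma * lambdax^-1 by rewrite mulr_gt0 ?invr_gt0.
  have cEy : 0 < gamma^-1 * lambday^-1 by rewrite mulr_gt0 ?invr_gt0.
  (* Each weighted square in [E k] is at most [E 0], which bounds both displacements from the
     solution. *)
  pose M := Num.max (Num.sqrt (E 0%N / (gamma * lambdax^-1)) + `|xs|)
    (Num.sqrt (E 0%N / (gamma^-1 * lambday^-1)) + `|ys|).
  apply: (@bounded_fun_le _ _ _ M) => k.
  rewrite prod_normE ge_max /=; apply/andP; split.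
    rewrite le_max; apply/orP; left.
    rewrite -{1}(subrK xs (x k)) (le_trans (ler_normD _ _))// lerD2r.
    apply: (norm_le_rdot cEx); apply: le_trans (Enon 0%N k (leq0n k)).
    by rewrite EE lerDl mulr_ge0 ?rdot_ge0// ltW.
  rewrite le_max; apply/orP; right.
  rewrite -{1}(subrK ys (y k)) (le_trans (ler_normD _ _))// lerD2r.
  apply: (norm_le_rdot cEy); apply: le_trans (Enon 0%N k (leq0n k)).
  by rewrite EE lerDr mulr_ge0 ?rdot_ge0// ltW.
have ab_cvg : (fun k => (x k, y k) - (xb k, yb k)) @ \oo
    --> (0 : 'rV[R]_n * 'rV[R]_n).
  exact: (cvg_pair acvg bcvg).
have xyb_bounded : bounded_fun (fun k => (xb k, yb k)).
  have [M [_ hM]] := xy_bounded.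
  have [M' [_ hM']] := cvg_seq_bounded (cvgP _ ab_cvg).
  (* Boundedness only supplies bounds strictly above [M] and [M'], hence the added units. *)
  apply: (@bounded_fun_le _ _ _ ((M + 1) + (M' + 1))) => k.
  rewrite -(subKr (x k, y k) (xb k, yb k)) (le_trans (ler_normB _ _))// lerD//.
    by apply: hM => //; rewrite ltrDl.
  by apply: hM' => //; rewrite ltrDl.
have cl_xy : cluster ((fun k => (x k, y k)) @ \oo) `<=` link X S.
  move=> z zxy.
  have XXz : ([set u | u \in X] `*` [set u | u \in orthocomp X]) z.
    have XXclosed := closed_setM (@closed_vspace _ _ X)
      (@closed_vspace _ _ (orthocomp X)).
    apply: (closed_cluster_seq XXclosed _ zxy) => k.
    by split; [exact: xX|exact: yX].
  have Sz : gph S z.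
    (* The pairs [(q k, s k)] lie on the closed graph and differ from [(x k, y k)] by a null
       sequence, so cluster points of the iterates are on the graph. *)
    apply: (closed_cluster_seq (f := fun k => (q k, s k)) hosc qS).
    apply: cluster_sub_cvg0 zxy.
    rewrite (_ : (fun k => _) =
        fun k => (a k - gamma^-1 *: b k, b k - gamma *: a k)); last first.
      by apply/funext => k; rewrite qE sE; congr pair; apply/rowP => i;
        rewrite !mxE; ring.
    have cvg0 (c : R) (f g : nat -> 'rV[R]_n) : f @ \oo --> (0 : 'rV[R]_n) ->
        g @ \oo --> (0 : 'rV[R]_n) ->
        (fun k => f k - c *: g k) @ \oo --> (0 : 'rV[R]_n).
      move=> f0 g0'; rewrite -(subr0 (0 : 'rV[R]_n)) -{2}(scaler0 _ c).
      by apply: cvgB f0 _; exact: cvgZl_tmp.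
    exact: (cvg_pair (cvg0 _ _ _ acvg bcvg) (cvg0 _ _ _ bcvg acvg)).
  by case: XXz.
have ba_cvg : (fun k => (xb k, yb k) - (x k, y k)) @ \oo
    --> (0 : 'rV[R]_n * 'rV[R]_n).
  rewrite -oppr0; under eq_fun do rewrite -opprB.
  exact: cvgN ab_cvg.
have cl_xyb : cluster ((fun k => (xb k, yb k)) @ \oo) `<=` link X S.
  by apply: subset_trans cl_xy; exact: cluster_sub_cvg0 ba_cvg.
split => //.
- split=> // [N|smono].
    apply: le_trans (min_le_average D N) _.
    by rewrite invfM [X in _ <= _ * X]mulrC mulrA ler_wpM2r ?invr_ge0 ?ler0n.
  have Dnon : nonincreasing_seq D.
    apply/nonincreasing_seqP => k.
    have := semimonotone_residual g0 (smono (q k, s k) (qS k)) (qS k.+1)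
      (rpredB (xX k.+1) (xX k)) (rpredB (aX k.+1) (aX k))
      (rpredB (yX k.+1) (yX k)) (rpredB (bX k.+1) (bX k)).
    have -> : q k.+1 - q k = x k.+1 - x k - (a k.+1 - a k)
        + gamma^-1 *: (b k.+1 - b k).
      by rewrite !qE; apply/rowP => i; rewrite !mxE; ring.
    have -> : s k.+1 - s k = gamma *: (a k.+1 - a k)
        + (y k.+1 - y k - (b k.+1 - b k)).
      by rewrite !sE; apply/rowP => i; rewrite !mxE; ring.
    move=> /(_ erefl erefl) /(le_trans (residual_le_min g0 lx0 ly0 mu rho _ _)).
    rewrite -/alpha; have := residual_ge0 g0 lx0 ly0 (a k.+1 - a k) (b k.+1 - b k).
    have -> : D k.+1 = D k
        + residual gamma lambdax lambday (a k.+1 - a k) (b k.+1 - b k)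
        + 2 * (gamma * rdot (lambdax *: a k) (a k.+1 - a k)
               + gamma^-1 * rdot (lambday *: b k) (b k.+1 - b k)).
      by rewrite !DE -residualD !(addrC (_ k)) !subrK.
    have -> : x k.+1 - x k = - (lambdax *: a k) by rewrite xS addrAC subrr add0r.
    have -> : y k.+1 - y k = - (lambday *: b k) by rewrite yS addrAC subrr add0r.
    (* Coercivity now reads [alpha * r <= - p], so the increment [r + 2 * p] of [D] is at most
       [(1 - 2 * alpha) * r], which is nonpositive. *)
    rewrite !rdotNl !mulrN -opprD; set r := residual _ _ _ _ _; set p := _ + _.
    have := ltW alpha0; nra.
  by split=> // N; exact: bigmin_nonincreasing.
- move=> link1; exists (xs, ys).
  (* By (iii) both sequences are bounded with all cluster points in the singleton link. *)
  by split=> //; apply: bounded_cvg_cluster1 => //; rewrite link1.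
Qed.
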